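(* Let $n\ge 2$ and let $(x_{i_1},x_{i_2},\ldots,x_{i_k})$ be a fixed finite sequence of Artin generators of the braid group $\mathcal{B}_n$. For $(a_1,\ldots,a_k)\in\mathbb{Z}^k$ let $P_n(a_1,\ldots,a_k)\in\mathbb{C}[l^{\pm1},m^{\pm1}]$ denote the HOMFLY polynomial of the closure of the $n$-braid $x_{i_1}^{a_1}x_{i_2}^{a_2}\cdots x_{i_k}^{a_k}$. Then for any $a_1,\ldots,a_k\in\mathbb{Z}$ and any $j\in\{1,\ldots,k\}$, $$P_n(a_1,\ldots,a_j+2,\ldots,a_k)+ml\,P_n(a_1,\ldots,a_j+1,\ldots,a_k)+l^2\,P_n(a_1,\ldots,a_j,\ldots,a_k)=0.$$
   Context: The HOMFLY polynomial is the oriented link invariant $P$ with values in $\mathbb{C}[l^{\pm1},m^{\pm1}]$ determined by $P(\bigcirc)=1$ (unknot) and the skein relation $lP(L_+)+l^{-1}P(L_-)+mP(L_0)=0$ whenever $L_+,L_-,L_0$ are oriented diagrams identical except near one crossing, where $L_+$ has a positive crossing (both strands pointing up, the over-strand goes from lower left to upper right), $L_-$ a negative crossing (over-strand from lower right to upper left) and $L_0$ the oriented smoothing. Braid convention: $\mathcal{B}_n$ has Artin generators $x_1,\ldots,x_{n-1}$; in $x_i$ the strand going from top position $i$ to bottom position $i+1$ passes over the strand going from top position $i+1$ to bottom position $i$. Braids are oriented from top to bottom, products are concatenations, so each crossing $x_i$ in the (oriented) closure of a braid is a negative crossing (type $L_-$) and each $x_i^{-1}$ is a positive crossing. *)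

(* Defs.v *)
From HB Require Import structures.
From Stdlib Require Import Relations.Relation_Operators.
From mathcomp Require Import all_boot all_order all_algebra.
From mathcomp Require Import boolp reals complex.

Set Implicit Arguments.
Unset Strict Implicit.
Unset Printing Implicit Defensive.

Import GRing.Theory.
Local Open Scope ring_scope.

(* K[l^+-1, m^+-1], as the subring of K(l, m) of the fractions whose
   denominator is a power of l m. *)

Section Laurent.
Variable K : idomainType.

Local Notation rational := {fraction {poly {poly K}}}.

Definition lfrac : rational := FracField.tofrac 'X.
Definition mfrac : rational := FracField.tofrac ('X%:P).

Definition is_laurent : {pred rational} := fun x =>
  `[< exists (N : nat) (p : {poly {poly K}}),
        x * (lfrac * mfrac) ^+ N = FracField.tofrac p >].

Lemma is_laurentP x :
  reflect (exists (N : nat) (p : {poly {poly K}}),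
             x * (lfrac * mfrac) ^+ N = FracField.tofrac p)
          (x \in is_laurent).
Proof. exact: asboolP. Qed.

Lemma is_laurent_tofrac p : FracField.tofrac p \in is_laurent.
Proof. by apply/is_laurentP; exists 0%N, p; rewrite expr0 mulr1. Qed.

Lemma is_laurent_subring : subring_closed is_laurent.
Proof.
split; first by rewrite -tofrac1 is_laurent_tofrac.
- move=> x y /is_laurentP[N [p hp]] /is_laurentP[M [q hq]].
  pose w : {poly {poly K}} := 'X * 'X%:P.
  have wE : lfrac * mfrac = FracField.tofrac w by rewrite /w tofracM.
  apply/is_laurentP; exists (N + M)%N, (p * w ^+ M - q * w ^+ N).
  rewrite tofracB !tofracM !tofracXn -wE -hp -hq mulrBl exprD !mulrA.
  by rewrite -(mulrA y) [_ ^+ N * _ ^+ M]mulrC !mulrA.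
- move=> x y /is_laurentP[N [p hp]] /is_laurentP[M [q hq]].
  apply/is_laurentP; exists (N + M)%N, (p * q).
  by rewrite tofracM -hp -hq exprD mulrACA.
Qed.

HB.instance Definition _ :=
  GRing.isSubringClosed.Build rational is_laurent is_laurent_subring.

Record laurent :=
  Laurent { laurent_val :> rational; laurentP : laurent_val \in is_laurent }.

HB.instance Definition _ := [isSub for laurent_val].
HB.instance Definition _ := [Choice of laurent by <:].
HB.instance Definition _ := [SubChoice_isSubComNzRing of laurent by <:].

Lemma lfrac_neq0 : lfrac != 0.
Proof. by rewrite tofrac_eq0 polyX_eq0. Qed.

Lemma mfrac_neq0 : mfrac != 0.
Proof. by rewrite tofrac_eq0 polyC_eq0 polyX_eq0. Qed.

Lemma lfracV_laurent : lfrac^-1 \in is_laurent.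
Proof.
apply/is_laurentP; exists 1%N, ('X%:P).
by rewrite expr1 mulKf // lfrac_neq0.
Qed.

Definition lvar : laurent := Laurent (is_laurent_tofrac 'X).
Definition lvarV : laurent := Laurent lfracV_laurent.
Definition mvar : laurent := Laurent (is_laurent_tofrac ('X%:P)).

Lemma lvarK : lvar * lvarV = 1.
Proof. by apply: val_inj; rewrite /= mulfV // lfrac_neq0. Qed.

End Laurent.

(* A planar link diagram in general position with respect to the height
   function is cut by horizontal lines into layers, each containing one local
   maximum, one local minimum or one crossing.  Layers are listed from top to
   bottom.  The index of a layer is the number of strands on its left. *)
Inductive layer : Type :=
  (* local maximum; the boolean tells whether its left leg points down
     (and hence its right leg up) *)
  | Cap of nat & bool
  (* local minimum *)
  | Cup of nat
  (* crossing; [true]: the strand going from the top left to the bottom right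
     passes over; [false]: the other strand does *)
  | Cross of nat & bool.

(* A horizontal line meets the diagram in finitely many points, recorded from
   left to right by the orientation of the strand there ([true]: downwards).
   [cross_layer c s] is the record below the layer [c] if the record above it
   is [s]; it is [None] if the layer does not fit. *)
Definition cross_layer (c : layer) (s : seq bool) : option (seq bool) :=
  match c with
  | Cap i b =>
      if (i <= size s)%N then Some (take i s ++ [:: b, ~~ b & drop i s])
      else None
  | Cup i =>
      if drop i s is [:: x, y & s'] then
        if x != y then Some (take i s ++ s') else None
      else None
  | Cross i _ =>
      if drop i s is [:: x, y & s'] then Some (take i s ++ [:: y, x & s'])
      else None
  end.

Fixpoint cross_layers (w : seq layer) (s : seq bool) : option (seq bool) :=
  if w is c :: w' then obind (cross_layers w') (cross_layer c s) else Some s.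

(* The empty diagram is included. *)
Record diagram := Diagram {
  layers :> seq layer;
  diagramP : cross_layers layers [::] == Some [::]
}.

Definition layer_in (c : layer) : nat := if c is Cap _ _ then 0 else 2.
Definition layer_out (c : layer) : nat := if c is Cup _ then 0 else 2.
Definition layer_pos (c : layer) : nat :=
  match c with Cap i _ | Cup i | Cross i _ => i end.
Definition layer_shift (d : nat) (c : layer) : layer :=
  match c with
  | Cap i b => Cap (d + i) b
  | Cup i => Cup (d + i)
  | Cross i o => Cross (d + i) o
  end.

(* Planar isotopies and Reidemeister moves of diagrams cut into layers
   (the Freyd-Yetter presentation of the category of tangles). *)
Inductive local_move : seq layer -> seq layer -> Prop :=
  | exchange c d : (layer_pos c <= layer_pos d)%N ->
      local_move [:: c; layer_shift (layer_out c) d]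
                 [:: layer_shift (layer_in c) d; c]
  | zigzag_left i b : local_move [:: Cap i b; Cup i.+1] [::]
  | zigzag_right i b : local_move [:: Cap i.+1 b; Cup i] [::]
  | slide_cap i b o :
      local_move [:: Cap i b; Cross i.+1 o] [:: Cap i.+1 b; Cross i (~~ o)]
  | slide_cup i o :
      local_move [:: Cross i o; Cup i.+1] [:: Cross i.+1 (~~ o); Cup i]
  | reidemeister1_cap i b o : local_move [:: Cap i b; Cross i o] [:: Cap i (~~ b)]
  | reidemeister1_cup i o : local_move [:: Cross i o; Cup i] [:: Cup i]
  | reidemeister2 i o : local_move [:: Cross i o; Cross i (~~ o)] [::]
  | reidemeister3 i o :
      local_move [:: Cross i o; Cross i.+1 o; Cross i o]
                 [:: Cross i.+1 o; Cross i o; Cross i.+1 o].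

Definition diagram_move (D E : diagram) : Prop :=
  exists u v a b, [/\ local_move a b, D = u ++ a ++ v :> seq layer
                    & E = u ++ b ++ v :> seq layer].

Definition isotopic : diagram -> diagram -> Prop :=
  clos_refl_sym_trans diagram diagram_move.

Definition link_invariant (T : Type) (P : diagram -> T) : Prop :=
  forall D E, isotopic D E -> P D = P E.

(* [x] and [y] are the orientations of the strands at the top left and at the
   top right of the crossing.  If both strands point the same way (up or down,
   the two pictures differing by a half turn), the crossing is positive when
   the strand joining the top right to the bottom left passes over. *)
Definition positive (x y o : bool) : bool := if x == y then ~~ o else o.

(* If exactly one strand points down, the oriented smoothing joins the two
   ends at the top, and the two ends at the bottom, whose orientations are,
   from left to right, [y] and [x = ~~ y]. *)
Definition smoothing (i : nat) (x y : bool) : seq layer :=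
  if x == y then [::] else [:: Cup i; Cap i y].

Definition skein_triple (Dpos Dneg Dzero : diagram) : Prop :=
  exists (u v : seq layer) (s : seq bool) (i : nat) (o : bool),
    let x := nth true s i in let y := nth true s i.+1 in
    [/\ cross_layers u [::] = Some s,
        positive x y o,
        Dpos = u ++ [:: Cross i o] ++ v :> seq layer,
        Dneg = u ++ [:: Cross i (~~ o)] ++ v :> seq layer
      & Dzero = u ++ smoothing i x y ++ v :> seq layer].

Lemma unknot_subproof : cross_layers [:: Cap 0 true; Cup 0] [::] == Some [::].
Proof. by []. Qed.

Definition unknot : diagram := Diagram unknot_subproof.

(* These properties determine P, except on the empty diagram. *)
Definition is_homfly (K : idomainType) (P : diagram -> laurent K) : Prop :=
  [/\ link_invariant P,
      P unknot = 1
    & forall Dpos Dneg Dzero, skein_triple Dpos Dneg Dzero ->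
        lvar K * P Dpos + lvarV K * P Dneg + mvar K * P Dzero = 0].

(* The letter (i, true) stands for the Artin generator with index i + 1, and
   (i, false) for its inverse. *)
Definition braid_word (n : nat) := seq ('I_n.-1 * bool).

Inductive braid_relation (n : nat) : braid_word n -> braid_word n -> Prop :=
  | braid_cancel (i : 'I_n.-1) e : braid_relation [:: (i, e); (i, ~~ e)] [::]
  | braid_far (i j : 'I_n.-1) : (i.+1 < j)%N ->
      braid_relation [:: (i, true); (j, true)] [:: (j, true); (i, true)]
  | braid_artin (i j : 'I_n.-1) : j = i.+1 :> nat ->
      braid_relation [:: (i, true); (j, true); (i, true)]
                     [:: (j, true); (i, true); (j, true)].

Definition braid_step (n : nat) (w1 w2 : braid_word n) : Prop :=
  exists u v a b,
    [/\ braid_relation a b, w1 = u ++ a ++ v & w2 = u ++ b ++ v].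

Definition braid_eq (n : nat) : braid_word n -> braid_word n -> Prop :=
  clos_refl_sym_trans (braid_word n) (@braid_step n).

Section BraidGroup.
Variable n : nat.
Implicit Types u v w : braid_word n.

Local Open Scope quotient_scope.

Definition braid_eqb : rel (braid_word n) := fun u v => `[< braid_eq u v >].

Lemma braid_eqb_equiv : equiv_class_of braid_eqb.
Proof.
split=> [u|u v|v u w].
- exact/asboolP/rst_refl.
- by apply/asboolP/asboolP; apply: rst_sym.
- by move=> /asboolP uv /asboolP vw; apply/asboolP; apply: rst_trans vw.
Qed.

Canonical braid_equiv := EquivRelPack braid_eqb_equiv.

Definition braid := {eq_quot braid_equiv}.

HB.instance Definition _ := Choice.on braid.
HB.instance Definition _ := EqQuotient.on braid.

Lemma braid_piP u v : \pi_braid u = \pi_braid v <-> braid_eq u v.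
Proof.
by split=> [/eqmodP/asboolP //|h]; apply/eqmodP/asboolP.
Qed.

Lemma braid_reprP u : braid_eq (repr (\pi_braid u)) u.
Proof. by apply/braid_piP; rewrite reprK. Qed.

Lemma braid_eq_cat u1 u2 v1 v2 :
  braid_eq u1 u2 -> braid_eq v1 v2 -> braid_eq (u1 ++ v1) (u2 ++ v2).
Proof.
move=> hu hv; apply: (rst_trans _ _ _ (u2 ++ v1)).
  elim: hu => {u1 u2} [u1 u2 [x [y [a [b [ab -> ->]]]]]|u|u1 u2 _|u1 u2 u3 _ + _].
  - by apply: rst_step; exists x, (y ++ v1), a, b; rewrite -!catA.
  - exact: rst_refl.
  - exact: rst_sym.
  - exact: rst_trans.
elim: hv => {v1 v2} [v1 v2 [x [y [a [b [ab -> ->]]]]]|v|v1 v2 _|v1 v2 v3 _ + _].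
- by apply: rst_step; exists (u2 ++ x), y, a, b; rewrite -!catA.
- exact: rst_refl.
- exact: rst_sym.
- exact: rst_trans.
Qed.

Definition word_inv u : braid_word n := rev [seq (c.1, ~~ c.2) | c <- u].

Lemma word_invK : involutive word_inv.
Proof.
move=> u; rewrite /word_inv map_rev revK -map_comp map_id_in //.
by move=> [i e] _ /=; rewrite negbK.
Qed.

Lemma word_inv_cat u v : word_inv (u ++ v) = word_inv v ++ word_inv u.
Proof. by rewrite /word_inv map_cat rev_cat. Qed.

Lemma braid_eq_catV u : braid_eq (u ++ word_inv u) [::].
Proof.
elim: u => [|[i e] u IHu]; first exact: rst_refl.
have -> : ((i, e) :: u) ++ word_inv ((i, e) :: u)
  = [:: (i, e)] ++ (u ++ word_inv u) ++ [:: (i, ~~ e)].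
  by rewrite -cat1s word_inv_cat -!catA.
apply: (rst_trans _ _ _ ([:: (i, e)] ++ [::] ++ [:: (i, ~~ e)])).
  apply: braid_eq_cat; first exact: rst_refl.
  by apply: braid_eq_cat IHu _; exact: rst_refl.
apply: rst_step; exists [::], [::], [:: (i, e); (i, ~~ e)], [::].
by split => //; exact: braid_cancel.
Qed.

Lemma braid_eq_catVl u : braid_eq (word_inv u ++ u) [::].
Proof. by have := braid_eq_catV (word_inv u); rewrite word_invK. Qed.

Definition braid_one : braid := \pi_braid [::].
Definition braid_mul (x y : braid) : braid := \pi_braid (repr x ++ repr y).
Definition braid_inv (x : braid) : braid := \pi_braid (word_inv (repr x)).

Lemma braid_mul_pi u v :
  braid_mul (\pi_braid u) (\pi_braid v) = \pi_braid (u ++ v).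
Proof. by apply/braid_piP; apply: braid_eq_cat; apply: braid_reprP. Qed.

Lemma braid_mulA : associative braid_mul.
Proof.
move=> x y z; rewrite -[x]reprK -[y]reprK -[z]reprK.
rewrite (braid_mul_pi (repr y)) (braid_mul_pi (repr x) (repr y)).
by rewrite (braid_mul_pi (repr x)) (braid_mul_pi (_ ++ _)) catA.
Qed.

Lemma braid_mul1 : left_id braid_one braid_mul.
Proof. by move=> x; rewrite -[x]reprK /braid_one braid_mul_pi. Qed.

Lemma braid_mul1r : right_id braid_one braid_mul.
Proof. by move=> x; rewrite -[x]reprK /braid_one braid_mul_pi cats0. Qed.

Lemma braid_mulV : left_inverse braid_one braid_inv braid_mul.
Proof.
move=> x; rewrite -{2}[x]reprK braid_mul_pi.
exact/braid_piP/braid_eq_catVl.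
Qed.

Lemma braid_mulrV : right_inverse braid_one braid_inv braid_mul.
Proof.
move=> x; rewrite -{1}[x]reprK braid_mul_pi.
exact/braid_piP/braid_eq_catV.
Qed.

HB.instance Definition _ := isGroup.Build braid
  braid_mulA braid_mul1 braid_mul1r braid_mulV braid_mulrV.

Definition artin (i : 'I_n.-1) : braid := \pi_braid [:: (i, true)].

End BraidGroup.

Definition expgz (G : groupType) (x : G) (a : int) : G :=
  match a with
  | Posz e => (x ^+ e)%g
  | Negz e => (x ^- e.+1)%g
  end.

(* The letter (i, true) is drawn with the strand going from the top left to
   the bottom right over the other one. *)
Definition braid_layers (n : nat) (w : braid_word n) : seq layer :=
  [seq Cross (val c.1) c.2 | c <- w].

(* The n strands of the braid run downwards on the left; nested arcs close
   them on the right. *)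
Definition closure_layers (n : nat) (w : braid_word n) : seq layer :=
  [seq Cap i true | i <- iota 0 n] ++ braid_layers w
    ++ [seq Cup i | i <- rev (iota 0 n)].

Lemma cross_layers_cat u v s :
  cross_layers (u ++ v) s = obind (cross_layers v) (cross_layers u s).
Proof. by elim: u s => //= c u IHu s; case: cross_layer. Qed.

Lemma iota_rcons n : iota 0 n.+1 = iota 0 n ++ [:: n].
Proof. by rewrite -addn1 iotaD. Qed.

Lemma nseq_rcons n : nseq n.+1 true = nseq n true ++ [:: true].
Proof. by rewrite -addn1 nseqD. Qed.

Lemma cross_caps n :
  cross_layers [seq Cap i true | i <- iota 0 n] [::]
  = Some (nseq n true ++ nseq n false).
Proof.
elim: n => // n IHn; rewrite iota_rcons map_cat cross_layers_cat IHn.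
rewrite nseq_rcons -catA /= size_cat !size_nseq leq_addr.
by rewrite take_size_cat ?drop_size_cat ?size_nseq.
Qed.

Lemma cross_cups n :
  cross_layers [seq Cup i | i <- rev (iota 0 n)] (nseq n true ++ nseq n false)
  = Some [::].
Proof.
elim: n => // n IHn; rewrite iota_rcons rev_cat map_cat nseq_rcons -catA /=.
by rewrite drop_size_cat ?take_size_cat ?size_nseq.
Qed.

Lemma cross_braid_layers n (w : braid_word n) t :
  cross_layers (braid_layers w) (nseq n true ++ t) = Some (nseq n true ++ t).
Proof.
elim: w => // -[[i ltin] o] w IHw /=.
have {}ltin : (i.+1 < n)%N by case: n ltin {w IHw}.
have nE : nseq n true = nseq i true ++ [:: true, true & nseq (n - i.+2) true].
  by rewrite -[[:: _, _ & _]]/(nseq (n - i.+2).+2 true) -nseqD -2!addSnnS subnKC.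
have -> : nseq n true ++ t
  = nseq i true ++ [:: true, true & nseq (n - i.+2) true ++ t].
  by rewrite nE -catA.
rewrite drop_size_cat ?size_nseq //= take_size_cat ?size_nseq //.
by rewrite nE -catA in IHw.
Qed.

Lemma closure_subproof n (w : braid_word n) :
  cross_layers (closure_layers w) [::] == Some [::].
Proof.
by rewrite !cross_layers_cat cross_caps /= cross_layers_cat cross_braid_layers
  /= cross_cups.
Qed.

Definition word_closure (n : nat) (w : braid_word n) : diagram :=
  Diagram (closure_subproof w).

(* The closure of a braid is a well-defined link; it is represented by the
   closure of an arbitrary word representing the braid. *)
Definition braid_closure (n : nat) (x : braid n) : diagram :=
  word_closure (repr x).

Definition power_braid (n k : nat) (i : 'I_k -> 'I_n.-1) (a : 'I_k -> int)
    : braid n :=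
  (\big[*%g/1]_(t < k) expgz (@artin n (i t)) (a t))%g.

(* Main.v *)
(* If the closures of beta x^(a+2) gamma and beta x^a gamma are drawn from words
   that agree up to the letters x and x^-1 inserted in beta x^(a+1) gamma, then
   they form a skein triple with the closure of beta x^(a+1) gamma, and the
   relation is l times the skein relation.  Such words may be chosen freely
   because each relation of the braid group is a Reidemeister move or a planar
   isotopy. *)
Require Import Defs.
From Stdlib Require Import Relations.Relation_Operators.
From mathcomp Require Import all_boot all_order all_algebra.
From mathcomp Require Import reals complex.
From mathcomp Require Import ring.

Import GRing.Theory.
Local Open Scope ring_scope.
Local Open Scope complex_scope.

Lemma braid_layers_cat n (u v : braid_word n) :
  braid_layers (u ++ v) = braid_layers u ++ braid_layers v.
Proof. exact: map_cat. Qed.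

(** Cancellation is a Reidemeister II move, far commutation an exchange of layers, and the Artin
    relation a Reidemeister III move. *)
Lemma local_move_braid_relation n (a b : braid_word n) :
  braid_relation a b -> local_move (braid_layers a) (braid_layers b).
Proof.
case=> [i e|i j ij|i j jE] /=; first exact: reidemeister2.
(* [exchange] shifts its second layer by the two strands of the first, hence the index [j - 2]. *)
- have := @exchange (Cross i true) (Cross (j - 2) true).
  by rewrite /= subnKC ?(leq_ltn_trans _ ij) //; apply; rewrite leq_subRL ?(leq_ltn_trans _ ij).
- by rewrite jE; apply: reidemeister3.
Qed.

Lemma isotopic_word_closure n (u v : braid_word n) :
  braid_eq u v -> isotopic (word_closure u) (word_closure v).
Proof.
elim=> {u v} [_ _ [u [v [a [b [ab -> ->]]]]]|u|u v _|u v w _ + _].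
- apply: rst_step.
  exists ([seq Cap i true | i <- iota 0 n] ++ braid_layers u).
  exists (braid_layers v ++ [seq Cup i | i <- rev (iota 0 n)]).
  exists (braid_layers a), (braid_layers b).
  split; first exact: local_move_braid_relation.
  + by rewrite /= /closure_layers !braid_layers_cat -!catA.
  + by rewrite /= /closure_layers !braid_layers_cat -!catA.
- exact: rst_refl.
- exact: rst_sym.
- exact: rst_trans.
Qed.

Lemma link_invariant_braid_closure T (P : diagram -> T) n (w : braid_word n) :
  link_invariant P -> P (braid_closure (\pi_(braid n) w)%qT) = P (word_closure w).
Proof. by move=> invP; apply/invP/isotopic_word_closure/braid_reprP. Qed.

(** Both strands at the crossing point down, so [(i, false)] is the positive letter and the oriented
    smoothing adds no layer. *)
Lemma skein_triple_word_closure n (u v : braid_word n) (i : 'I_n.-1) :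
  skein_triple (word_closure (u ++ (i, false) :: v))
    (word_closure (u ++ (i, true) :: v)) (word_closure (u ++ v)).
Proof.
have i1n : (i.+1 < n)%N by case: n i {u v} => [[]|n []].
exists ([seq Cap i true | i <- iota 0 n] ++ braid_layers u).
exists (braid_layers v ++ [seq Cup i | i <- rev (iota 0 n)]).
(* Below [u] the [n] braid strands run down and the [n] closing strands run up. *)
exists (nseq n true ++ nseq n false), (val i), false.
rewrite !nth_cat !size_nseq (ltnW i1n) i1n !nth_nseq (ltnW i1n) i1n.
split=> //; first by rewrite cross_layers_cat cross_caps /= cross_braid_layers.
- by rewrite /= /closure_layers braid_layers_cat -!catA.
- by rewrite /= /closure_layers braid_layers_cat -!catA.
- by rewrite /= /closure_layers braid_layers_cat -!catA.
Qed.

Lemma mulg_braid_pi n (u v : braid_word n) :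
  (\pi_(braid n) u * \pi_(braid n) v)%g%qT = (\pi_(braid n) (u ++ v))%qT.
Proof. exact: braid_mul_pi. Qed.

Lemma artinV n (i : 'I_n.-1) :
  ((artin i)^-1)%g = (\pi_(braid n) [:: (i, false)])%qT.
Proof.
apply/mulg1_eq; rewrite mulg_braid_pi.
exact/braid_piP/(braid_eq_catV [:: (i, true)]).
Qed.

Lemma homfly_braid_skein (K : idomainType) (P : diagram -> laurent K) n
    (x y : braid n) (i : 'I_n.-1) :
  is_homfly P ->
  P (braid_closure (x * artin i * y)%g)
    + mvar K * lvar K * P (braid_closure (x * y)%g)
    + lvar K ^+ 2 * P (braid_closure (x * (artin i)^-1 * y)%g) = 0.
Proof.
case=> invP _ skeinP; rewrite artinV -[x]reprK -[y]reprK /artin.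
rewrite !(mulg_braid_pi _ (repr x)) !mulg_braid_pi !link_invariant_braid_closure // -!catA /=.
have /skeinP := skein_triple_word_closure n (repr x) (repr y) i.
set p := P _; set q := P _; set r := P _ => skein.
(* For [ring], [lvarV K] is unrelated to [lvar K]; the last summand corrects for this and vanishes
   by [lvarK]. *)
have -> : q + mvar K * lvar K * r + lvar K ^+ 2 * p
  = lvar K * (lvar K * p + lvarV K * q + mvar K * r) + (1 - lvar K * lvarV K) * q.
  by ring.
by rewrite skein lvarK subrr mulr0 mul0r addr0.
Qed.

Lemma expgzD1 (G : groupType) (x : G) (a : int) :
  expgz x (a + 1) = (expgz x a * x)%g.
Proof.
(* The exponent is nonnegative, equal to -1, or at most -2. *)
case: a => [m|[|m]].
- by rewrite -PoszD addn1 /= expgSr.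
- by rewrite /= expg1 mulVg.
- have -> : Negz m.+1 + 1 = Negz m by rewrite !NegzE -(addn1 m.+1) PoszD; ring.
  by rewrite /= (expgS _ m.+1) invgM mulgVK.
Qed.

(** The index [j] is enumerated exactly once, so the factors before and after it do not depend on
    [c]; one pair [x], [y] thus serves all three exponents. *)
Lemma power_braid_with n k (i : 'I_k -> 'I_n.-1) (a : 'I_k -> int) (j : 'I_k) :
  exists x y : braid n, forall c,
    power_braid i [eta a with j |-> c] = (x * expgz (artin (i j)) c * y)%g.
Proof.
have := index_enum_uniq 'I_k.
rewrite /power_braid; case/splitPr: (mem_index_enum j) => r s.
rewrite cat_uniq /= => /and3P[_ /norP[jr _] /andP[js _]].
pose F t := expgz (artin (i t)) (a t).
exists (\big[*%g/1]_(t <- r) F t)%g, (\big[*%g/1]_(t <- s) F t)%g => c.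
have neqE q : j \notin q ->
    (\big[*%g/1]_(t <- q) expgz (artin (i t)) ([eta a with j |-> c] t)
       = \big[*%g/1]_(t <- q) F t)%g.
  move=> jq; apply: eq_big_seq => t tq /=.
  by case: eqP => // tj; rewrite -tj tq in jq.
by rewrite big_cat big_cons /= eqxx !neqE // mulgA.
Qed.

Theorem theorem1p1 (R : realType) (P : diagram -> laurent R[i])
    (hP : is_homfly P) (n : nat) (hn : (2 <= n)%N) (k : nat)
    (i : 'I_k -> 'I_n.-1) (a : 'I_k -> int) (j : 'I_k) :
  let Pn (b : 'I_k -> int) := P (braid_closure (power_braid i b)) in
  Pn [eta a with j |-> a j + 2]
    + mvar R[i] * lvar R[i] * Pn [eta a with j |-> a j + 1]
    + lvar R[i] ^+ 2 * Pn a = 0.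
Proof.
move=> Pn; rewrite /Pn; have [x [y powE]] := power_braid_with n k i a j.
have aE : power_braid i a = power_braid i [eta a with j |-> a j].
  by apply: eq_bigr => t _ /=; case: eqP => // ->.
(* Both outer powers are written as the middle one times a single letter, so that [x] times the
   middle power is the left factor in [homfly_braid_skein]. *)
have a2E : expgz (artin (i j)) (a j + 2)
  = (expgz (artin (i j)) (a j + 1) * artin (i j))%g by rewrite -expgzD1 -addrA.
have a0E : expgz (artin (i j)) (a j)
  = (expgz (artin (i j)) (a j + 1) * (artin (i j))^-1)%g by rewrite expgzD1 mulgK.
rewrite aE !powE a2E a0E !(mulgA x); exact: homfly_braid_skein.
Qed.
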